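(* Let $p,q$ be probability distributions on a finite set $\mathcal X$ and let $0\le\varepsilon<1$. For clips $c'<1<c''$, define $$L=\{i: p(i)/q(i)<c'\},\quad M=\{i: p(i)/q(i)\in[c',c'']\},\quad H=\{i:p(i)/q(i)>c''\}.$$ Let $\bar H=\{x:p(x)/q(x)=\infty\}$ and $\bar L=\{x:p(x)/q(x)=0\}$. Consider the fixed point equations $$\text{(U)}\quad p(H)-c''q(H)=\frac{\varepsilon}{1+\varepsilon},\qquad\text{and}\qquad \text{(Lo)}\quad q(L)-\frac{p(L)}{c'}=\frac{\varepsilon}{1+\varepsilon}.$$ For robust binary hypothesis testing between $p$ and $q$ with $\varepsilon$-subtractive contamination, the following hold. (a) If solutions $c'$ and $c''$ can be found to the fixed point equations (U) and (Lo), then least favourable distributions $(p^*_{\mathrm{Sub}},q^*_{\mathrm{Sub}})$ are given by $$p^*_{\mathrm{Sub}}(i)=\begin{cases}(1+\varepsilon)p(i), & i\in L,\\ (1+\varepsilon)p(i), & i\in M,\\ c''(1+\varepsilon)q(i), & i\in H,\end{cases}\qquad q^*_{\mathrm{Sub}}(i)=\begin{cases}\frac{1+\varepsilon}{c'}\,p(i), & i\in L,\\ (1+\varepsilon)q(i), & i\in M,\\ (1+\varepsilon)q(i), & i\in H.\end{cases}$$ (b) A solution does not exist for $c''$ only when $p(\bar H)>\varepsilon/(1+\varepsilon)$. When this happens, the least favourable distribution $p^*_{\mathrm{Sub}}$ is $$p^*_{\mathrm{Sub}}(i)=\begin{cases}(1+\varepsilon)p(i), & i\notin\bar H,\\ (1+\varepsilon)p(i)\Big(1-\frac{\varepsilon}{(1+\varepsilon)p(\bar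 H)}\Big), & i\in\bar H.\end{cases}$$ In this case, the formula for $q^*_{\mathrm{Sub}}$ is still given by the lower-clip formula in (a) (in terms of $c'$) when the lower clip $c'$ exists, and by part (c) when the lower clip also fails to exist. (c) A solution does not exist for $c'$ only when $q(\bar L)>\varepsilon/(1+\varepsilon)$. When this happens, the least favourable distribution $q^*_{\mathrm{Sub}}$ is $$q^*_{\mathrm{Sub}}(i)=\begin{cases}(1+\varepsilon)q(i), & i\notin\bar L,\\ (1+\varepsilon)q(i)\Big(1-\frac{\varepsilon}{(1+\varepsilon)q(\bar L)}\Big), & i\in\bar L.\end{cases}$$ In this case, the formula for $p^*_{\mathrm{Sub}}$ is still given by the upper-clip formula in (a) (in terms of $c''$) when the upper clip $c''$ exists, and by part (b) when the upper clip also fails to exist.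
   Context: $\Delta(\mathcal X)$ is the set of probability distributions on the finite set $\mathcal X$. For a distribution $p$ and a set $A\subseteq\mathcal X$, $p(A)=\sum_{x\in A}p(x)$. The ratio $p(x)/q(x)$ is $\infty$ when $p(x)>0$ and $q(x)=0$. The $\varepsilon$-subtractive uncertainty set around $p$ is $\mathcal P_{\mathrm{Sub}}(p,\varepsilon)=\{p'\in\Delta(\mathcal X): p'(x)\le(1+\varepsilon)p(x)\text{ for all }x\in\mathcal X\}$. In robust binary hypothesis testing between $p$ and $q$ with $\varepsilon$-subtractive contamination, the uncertainty sets are $\mathcal P=\mathcal P_{\mathrm{Sub}}(p,\varepsilon)$ under hypothesis 0 and $\mathcal Q=\mathcal P_{\mathrm{Sub}}(q,\varepsilon)$ under hypothesis 1; a test output of $0$ means deciding for $\mathcal P$ and an output of $1$ means deciding for $\mathcal Q$. Least favourable distributions: $p^*\in\mathcal P$ and $q^*\in\mathcal Q$ are least favourable if for every likelihood ratio test $\phi^*:\mathcal X\to\{0,1\}$ between $p^*$ and $q^*$, $$\sup_{P\in\mathcal P}\mathbb P_{X\sim P}(\phi^*(X)=1)\le\mathbb P_{X\sim p^*}(\phi^*(X)=1)\quad\text{and}\quad \sup_{Q\in\mathcal Q}\mathbb P_{X\sim Q}(\phi^*(X)=0)\le\mathbb P_{X\sim q^*}(\phi^*(X)=0).$$ Here a likelihood ratio test $\phi^*$ is a (possibly randomised) test parametrised by $T\in\mathbb R$ and $\kappa\in[0,1]$ with $\mathbb P(\phi^*(x)=0)$ equal to $1$ if $p^*(x)/q^*(x)>T$,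 to $\kappa$ if $p^*(x)/q^*(x)=T$, and to $0$ if $p^*(x)/q^*(x)<T$.
   Formalization: That non-existence of c''>1 (or 0<c'<1) forces the mass bound is shown for disjoint uncertainty sets (it fails for p=q, ε>0), or with clips over all positive reals; the ratio p*/q* is given one suitable fixed value at each point where p* and q* both vanish. *)

(* Defs.v *)
From HB Require Import structures.
From mathcomp Require Import all_boot all_order all_algebra.
From mathcomp Require Import all_classical all_reals ereal.

Set Implicit Arguments.
Unset Strict Implicit.
Unset Printing Implicit Defensive.

Import Order.TTheory GRing.Theory Num.Theory.
Local Open Scope classical_set_scope.
Local Open Scope ring_scope.

Definition Delta (R : realType) (X : finType) : set (X -> R) :=
  [set p | (forall x, 0 <= p x) /\ \sum_x p x = 1].

Definition mass (R : realType) (X : finType) (p : X -> R) (A : {set X}) : R :=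
  \sum_(x in A) p x.

Definition P_Sub (R : realType) (X : finType) (p : X -> R) (eps : R) :
    set (X -> R) :=
  [set p' | Delta p' /\ forall x, p' x <= (1 + eps) * p x].

(* In [\bar R] one has [0^-1 = +oo] and [0 * +oo = 0]: the ratio is [+oo] when
   [p x > 0 = q x], and it is [0] by convention when [p x = q x = 0]. *)
Definition lratio (R : realType) (X : finType) (p q : X -> R) (x : X) : \bar R :=
  ((p x)%:E / (q x)%:E)%E.

(* The likelihood ratio is not defined where both distributions vanish; a
   version of it is an extension to those points by values in [0, +oo]. *)
Definition ratio_version (R : realType) (X : finType) (p q : X -> R)
    (r : X -> \bar R) : Prop :=
  (forall x, (0 <= r x)%E) /\
  (forall x, (p x != 0) || (q x != 0) -> r x = lratio p q x).

(* A randomised test is represented by its probability of output 0. *)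
Definition lr_test (R : realType) (X : finType) (r : X -> \bar R) (T kappa : R)
    (x : X) : R :=
  if (T%:E < r x)%E then 1 else if r x == T%:E then kappa else 0.

Definition prob0 (R : realType) (X : finType) (P phi : X -> R) : R :=
  \sum_x P x * phi x.

Definition prob1 (R : realType) (X : finType) (P phi : X -> R) : R :=
  \sum_x P x * (1 - phi x).

(* [ps] and [qs] may vanish together at points that members of [PP] or [QQ]
   charge, so a version of the likelihood ratio has to be fixed; it is the same
   for all the thresholds [T] and randomisations [kappa]. *)
Definition least_favourable (R : realType) (X : finType)
    (PP QQ : set (X -> R)) (ps qs : X -> R) : Prop :=
  [/\ PP ps, QQ qs &
   exists r : X -> \bar R, ratio_version ps qs r /\
     forall T kappa : R, 0 <= kappa <= 1 ->
       let phi := lr_test r T kappa in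
       (ereal_sup [set (prob1 P phi)%:E | P in PP] <= (prob1 ps phi)%:E)%E /\
       (ereal_sup [set (prob0 Q phi)%:E | Q in QQ] <= (prob0 qs phi)%:E)%E].

Definition setL (R : realType) (X : finType) (p q : X -> R) (c' : R) : {set X} :=
  [set x | (lratio p q x < c'%:E)%E]%SET.

Definition setH (R : realType) (X : finType) (p q : X -> R) (c'' : R) :
    {set X} :=
  [set x | (c''%:E < lratio p q x)%E]%SET.

Definition setHbar (R : realType) (X : finType) (p q : X -> R) : {set X} :=
  [set x | lratio p q x == +oo%E]%SET.

Definition setLbar (R : realType) (X : finType) (p q : X -> R) : {set X} :=
  [set x | lratio p q x == 0%E]%SET.

Definition eqU (R : realType) (X : finType) (p q : X -> R) (eps c'' : R) : Prop :=
  mass p (setH p q c'') - c'' * mass q (setH p q c'') = eps / (1 + eps).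

Definition eqLo (R : realType) (X : finType) (p q : X -> R) (eps c' : R) : Prop :=
  mass q (setL p q c') - mass p (setL p q c') / c' = eps / (1 + eps).

Definition upper_clip (R : realType) (X : finType) (p q : X -> R) (eps c'' : R) :
    Prop :=
  1 < c'' /\ eqU p q eps c''.

Definition lower_clip (R : realType) (X : finType) (p q : X -> R) (eps c' : R) :
    Prop :=
  0 < c' < 1 /\ eqLo p q eps c'.

(* With M = {x : c' <= lratio p q x <= c''}, the complement of [setH] is L u M and the
   complement of [setL] is M u H, so each formula involves a single clip. *)
Definition p_clip (R : realType) (X : finType) (p q : X -> R) (eps c'' : R)
    (x : X) : R :=
  if x \in setH p q c'' then c'' * (1 + eps) * q x else (1 + eps) * p x.

Definition q_clip (R : realType) (X : finType) (p q : X -> R) (eps c' : R)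
    (x : X) : R :=
  if x \in setL p q c' then (1 + eps) / c' * p x else (1 + eps) * q x.

Definition p_noclip (R : realType) (X : finType) (p q : X -> R) (eps : R)
    (x : X) : R :=
  if x \in setHbar p q
  then (1 + eps) * p x * (1 - eps / ((1 + eps) * mass p (setHbar p q)))
  else (1 + eps) * p x.

Definition q_noclip (R : realType) (X : finType) (p q : X -> R) (eps : R)
    (x : X) : R :=
  if x \in setLbar p q
  then (1 + eps) * q x * (1 - eps / ((1 + eps) * mass q (setLbar p q)))
  else (1 + eps) * q x.

(* Main.v *)
Require Import Defs.
From mathcomp Require Import all_boot all_order all_algebra.
From mathcomp Require Import all_classical all_reals ereal.
From mathcomp Require Import topology normedtype ring lra.
Import Order.TTheory GRing.Theory Num.Theory.
Import numFieldNormedType.Exports.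
Local Open Scope classical_set_scope.
Local Open Scope ring_scope.

(* The trimmed distribution [ps] equals [(1 + eps) p], the pointwise upper bound
   of its uncertainty set, except on the upper region, where the likelihood
   ratio is constant and maximal.  For every threshold test the probability of
   output 1 is minimal there, so moving mass into that region cannot
   increase the error; symmetrically for [qs].  The clips exist by the
   intermediate value theorem for [c |-> \sum_x max (p x - c * q x, 0)], which
   decreases from 1 at [c = 0] to the [p]-mass of [{x : q x = 0}]; at [c = 1] it is
   the total variation distance, and it exceeds [eps / (1 + eps)] when the
   uncertainty sets are disjoint.  Exchanging [p] and [q] turns the lower clip
   [c'] into the upper clip [1 / c']. *)

(** * Likelihood ratios in the extended reals *)

Section Ratio.
Context {R : realType} {X : finType}.
Implicit Types (p q : X -> R) (a c : R) (x : X).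

Lemma lratioE p q x : 0 <= p x ->
  lratio p q x = if q x == 0 then (if p x == 0 then 0%E else +oo%E)
                 else (p x / q x)%:E.
Proof.
move=> p0; rewrite /lratio inver; case: ifPn => q0; last by rewrite EFinM.
case: ifPn => [/eqP ->|pn0]; first by rewrite mul0e.
by rewrite gt0_muley // lte_fin lt_neqAle eq_sym pn0.
Qed.

Lemma lratio_ge0 p q x : 0 <= p x -> 0 <= q x -> (0 <= lratio p q x)%E.
Proof.
move=> p0 q0; rewrite lratioE //; case: ifP => _.
  by case: ifP => _; rewrite // leey.
by rewrite lee_fin divr_ge0.
Qed.

(** Since 0/0 is 0 and [c] is nonnegative, a point where both vanish fails both sides; at
    [q x = 0 < p x] both hold. *)
Lemma lratio_gt p q c x : 0 <= p x -> 0 <= q x -> 0 <= c ->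
  (c%:E < lratio p q x)%E = (c * q x < p x).
Proof.
move=> p0 q0 c0; rewrite lratioE //; case: eqVneq => [->|qn0].
  rewrite mulr0 [in RHS]lt_neqAle p0 andbT eq_sym; case: eqVneq => _ /=.
    by rewrite lte_fin ltNge c0.
  by rewrite ltry.
by rewrite lte_fin ltr_pdivlMr // lt_neqAle eq_sym qn0.
Qed.

Lemma lratio_lt p q c x : 0 <= p x -> 0 <= q x -> 0 < c ->
  (lratio p q x < c%:E)%E = (p x == 0) || (p x < c * q x).
Proof.
move=> p0 q0 c0; rewrite lratioE //; case: eqVneq => [->|qn0].
  rewrite mulr0 [p x < 0]ltNge p0 orbF.
  by case: eqVneq => _ /=; rewrite ?lte_fin ?c0.
have {qn0 q0}q0 : 0 < q x by rewrite lt_neqAle eq_sym qn0.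
rewrite lte_fin ltr_pdivrMr //; case: eqVneq => [->|//] /=.
by rewrite mulr_gt0.
Qed.

Lemma lratio_eqy p q x : 0 <= p x ->
  (lratio p q x == +oo%E) = (p x != 0) && (q x == 0).
Proof.
by move=> p0; rewrite lratioE //; case: (q x == 0); case: (p x == 0).
Qed.

Lemma lratio_eq0 p q x : 0 <= p x -> (lratio p q x == 0%E) = (p x == 0).
Proof.
move=> p0; rewrite lratioE //; case: (eqVneq (q x) 0) => [_|q0].
  by case: (eqVneq (p x) 0) => _; rewrite ?eqxx.
by rewrite eqe mulf_eq0 invr_eq0 (negbTE q0) orbF.
Qed.

Lemma lratioZ p q a x : 0 < a -> 0 <= p x ->
  ((a * p x)%:E / (a * q x)%:E)%E = lratio p q x.
Proof.
move=> a0 p0; have an0 : a != 0 by rewrite gt_eqF.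
have := @lratioE (fun x => a * p x) (fun x => a * q x) x.
rewrite /(lratio (fun _ => _)) => -> /=; last by rewrite mulr_ge0 // ltW.
rewrite lratioE // !mulf_eq0 (negbTE an0) /=; case: eqVneq => // q0.
by rewrite -mulf_div divff // mul1r.
Qed.

End Ratio.

(** * Domination inside an uncertainty set, and monotone threshold tests *)

Section Domination.
Context {R : realType} {X : finType}.
Implicit Types (p q P psi : X -> R) (r : X -> \bar R).

(* [ps - P] has total mass 0 and is nonnegative off [A], where [psi - k]
   is nonnegative too, while [psi - k] vanishes on [A]. *)
Lemma P_Sub_dominated {p ps P psi} {eps k : R} (A : {set X}) :
  Delta ps -> (forall x, x \notin A -> ps x = (1 + eps) * p x) ->
  P_Sub p eps P ->
  (forall x, k <= psi x) -> (forall x, x \in A -> psi x = k) ->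
  \sum_x P x * psi x <= \sum_x ps x * psi x.
Proof.
move=> [_ ps1] psE [[_ P1] Ple] kle kE.
have H : 0 <= \sum_x (ps x - P x) * (psi x - k).
  apply: sumr_ge0 => x _; have [xA|xA] := boolP (x \in A).
    by rewrite kE // subrr mulr0.
  by rewrite mulr_ge0 ?subr_ge0 // psE.
rewrite -subr_ge0; apply: le_trans H _.
have -> : \sum_x (ps x - P x) * (psi x - k) =
  \sum_x (ps x * psi x - P x * psi x - k * (ps x - P x)).
  by apply: eq_bigr => x _; ring.
by rewrite !big_split /= !sumrN -mulr_sumr big_split /= sumrN ps1 P1 subrr
  mulr0 subr0.
Qed.

(** Separate domains let a test on [X] be compared with one at a constant ratio, modelled on
    [unit]. *)
Lemma lr_test_mono {Y : finType} r (s : Y -> \bar R) (T kappa : R) x y :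
  0 <= kappa <= 1 -> (r x <= s y)%E ->
  lr_test r T kappa x <= lr_test s T kappa y.
Proof.
move=> /andP[k0 k1] rs; rewrite /lr_test.
have [Ts|sT|Ts] := ltgtP T%:E (s y).
- by case: ifP => // _; case: ifP.
- have xT := le_lt_trans rs sT.
  by rewrite ltNge (ltW xT) /= (lt_eqF xT).
- by rewrite ltNge Ts rs /=; case: ifP.
Qed.

End Domination.

(** * From a pair of cuts to least favourable distributions *)

Section LeastFavourable.
Context {R : realType} {X : finType}.
Implicit Types (p q ps qs : X -> R) (H L : {set X}).

(* [ps] is the extreme member of [P_Sub p eps] with the mass of [H] trimmed so
   that the likelihood ratio becomes the constant [h] there, wherever the pair
   does not vanish. *)
Definition upper_cut p q (eps : R) ps H (h : \bar R) : Prop :=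
  [/\ P_Sub p eps ps /\ (forall x, x \notin H -> ps x = (1 + eps) * p x),
      forall x, x \in H -> (1 < lratio p q x)%E,
      forall x, x \in H -> (ps x != 0) || ((1 + eps) * q x != 0) ->
        ((ps x)%:E / ((1 + eps) * q x)%:E)%E = h &
      (forall x, x \notin H -> (lratio p q x <= h)%E) /\ (1 <= h)%E].

Definition lower_cut p q (eps : R) qs L (l : \bar R) : Prop :=
  [/\ P_Sub q eps qs /\ (forall x, x \notin L -> qs x = (1 + eps) * q x),
      forall x, x \in L -> (lratio p q x < 1)%E,
      forall x, x \in L -> ((1 + eps) * p x != 0) || (qs x != 0) ->
        (((1 + eps) * p x)%:E / (qs x)%:E)%E = l &
      (forall x, x \notin L -> (l <= lratio p q x)%E) /\ (0 <= l <= 1)%E].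

(** The value 1 separates [H] from [L] and [l] from [h], so a single version of the ratio stays
    between [l] and [h], and each error is bounded separately by domination. *)
Lemma cut_least_favourable {p q} {eps : R} {ps qs H L} {h l : \bar R} :
  Delta p -> Delta q -> 0 <= eps ->
  upper_cut p q eps ps H h -> lower_cut p q eps qs L l ->
  least_favourable (P_Sub p eps) (P_Sub q eps) ps qs.
Proof.
move=> [p0 _] [q0 _] eps0 [[psP psE] H1 Hh [nHh h1]] [[qsQ qsE] L1 Ll [nLl]].
move=> /andP[l0 l1].
have a0 : 0 < 1 + eps by rewrite ltr_wpDr.
have HL x : x \in H -> x \notin L.
  by move=> /H1 x1; apply/negP => /L1 /(lt_trans x1); rewrite ltxx.
(* Where [ps] and [qs] vanish together inside a cut, the version takes the value of that cut, so
   every threshold test is constant on all of [H] and on all of [L]. *)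
pose r x := if x \in H then h else if x \in L then l else lratio p q x.
have r_le x : (r x <= h)%E.
  rewrite /r; case: ifPn => // xH; case: ifPn => xL; first exact: le_trans h1.
  exact: nHh.
have r_ge x : (l <= r x)%E.
  rewrite /r; case: ifPn => xH; first exact: le_trans h1.
  by case: ifPn => // /nLl.
split => //; exists r; split.
  split=> [x|x]; first exact: le_trans (r_ge x).
  rewrite /r /lratio; case: ifPn => [xH|xH].
    by rewrite (qsE x (HL x xH)) => /(Hh _ xH).
  rewrite (psE x xH); case: ifPn => [xL /(Ll _ xL) //|xL _].
  by rewrite (qsE x xL) lratioZ.
move=> T kappa k01 phi.
split; apply: ge_ereal_sup => _ [P PP <-]; rewrite lee_fin.
  (* [k] is the probability of output 0 at the upper bound [h] of the ratio, so [1 - phi] is at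
     least [1 - k], with equality on [H]. *)
  pose k := lr_test (fun _ : unit => h) T kappa tt.
  apply: (P_Sub_dominated (k := 1 - k) H psP.1 psE PP) => [x|x xH].
    by rewrite lerD2l lerN2; exact: lr_test_mono.
  by rewrite /phi /k /lr_test /r xH.
pose k := lr_test (fun _ : unit => l) T kappa tt.
apply: (P_Sub_dominated (k := k) L qsQ.1 qsE PP) => [x|x xL].
  exact: lr_test_mono.
have xH : x \notin H by apply: contraTN xL => /HL.
by rewrite /phi /k /lr_test /r xL (negbTE xH).
Qed.

End LeastFavourable.

(** * The excess function: clip equations, continuity and limiting value *)

Section Excess.
Context {R : realType} {X : finType}.
Implicit Types (p q : X -> R) (c v : R).

(** The hockey-stick divergence of [p] from [q]. As a sum of positive parts it is visibly continuous
    in [c], while the sets in [eqU] and [eqLo] jump. *)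
Definition excess p q c : R := \sum_x Num.max (p x - c * q x) 0.

Lemma massE (P : X -> R) (A : {set X}) :
  mass P A = \sum_x if x \in A then P x else 0.
Proof. by rewrite /mass big_mkcond. Qed.

Lemma excess_setH p q c : Delta p -> Delta q -> 0 <= c ->
  mass p (setH p q c) - c * mass q (setH p q c) = excess p q c.
Proof.
move=> [p0 _] [q0 _] c0; rewrite !massE mulr_sumr -sumrB /excess.
apply: eq_bigr => x _; rewrite finset.in_set lratio_gt //.
by case: ltP => H; [rewrite max_l|rewrite max_r]; lra.
Qed.

(** Division by [c] turns the lower equation into the upper one for the exchanged pair at [c^-1].
    Points with [p x = 0] all lie in [setL] and contribute [q x] on both sides. *)
Lemma excess_setL p q c : Delta p -> Delta q -> 0 < c ->
  mass q (setL p q c) - mass p (setL p q c) / c = excess q p c^-1.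
Proof.
move=> [p0 _] [q0 _] c0; rewrite !massE mulr_suml -sumrB /excess.
apply: eq_bigr => x _; rewrite finset.in_set lratio_lt //.
case: eqVneq => /= [->|_].
  by rewrite mul0r mulr0 subr0 max_l.
rewrite -ltr_pdivrMl //.
by case: ltP => H; [rewrite max_l|rewrite max_r]; lra.
Qed.

(** [setLbar p q] also holds the points where both vanish, but these carry no [q]-mass. *)
Lemma mass_setLbar p q : Delta p -> Delta q ->
  mass q (setLbar p q) = mass q (setHbar q p).
Proof.
move=> [p0 _] [q0 _]; rewrite !massE; apply: eq_bigr => x _.
rewrite !finset.in_set lratio_eq0 // lratio_eqy //.
by case: (eqVneq (q x) 0) => [->|//]; rewrite if_same.
Qed.

Lemma excess0 p q : Delta p -> excess p q 0 = 1.
Proof.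
move=> [p0 <-]; apply: eq_bigr => x _.
by rewrite mul0r subr0 max_l.
Qed.

Lemma excess1C {p q} : Delta p -> Delta q -> excess p q 1 = excess q p 1.
Proof.
move=> [_ p1] [_ q1]; apply/eqP; rewrite -subr_eq0 -sumrB.
rewrite (eq_bigr (fun x => p x - q x)) ?sumrB ?p1 ?q1 ?subrr // => x _.
rewrite !mul1r; case: (leP (p x) (q x)) => H.
  by rewrite max_r ?max_l; lra.
by rewrite max_l ?max_r; lra.
Qed.

Lemma excess_continuous p q : continuous (excess p q).
Proof.
apply: (continuous_big (op := +%R)) => [|x _]; first exact: add_continuous.
move=> c.
apply: (@continuous_max _ _ (fun c => p x - c * q x) (fun=> 0));
  last exact: cst_continuous.
by apply: continuousB; [exact: cst_continuous|exact: mulrr_continuous].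
Qed.

(** Points with [q x = 0] contribute [p x] for every [c]; the other terms are nonnegative. *)
Lemma excess_ge_mass {p} q c : Delta p -> mass p (setHbar p q) <= excess p q c.
Proof.
move=> [p0 _]; rewrite massE; apply: ler_sum => x _.
rewrite finset.in_set lratio_eqy //; case: eqVneq => /= _.
  by rewrite le_max lexx orbT.
case: eqVneq => [->|_]; first by rewrite mulr0 subr0 le_max lexx.
by rewrite le_max lexx orbT.
Qed.

(** The sum dominates each finite ratio, so all terms with [q x > 0] vanish. As real division by 0
    gives 0, points with [q x = 0] add nothing to the sum. *)
Lemma excess_eq_mass p q c : Delta p -> Delta q ->
  \sum_x p x / q x <= c -> excess p q c = mass p (setHbar p q).
Proof.
move=> [p0 _] [q0 _] cge; rewrite massE; apply: eq_bigr => x _.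
rewrite finset.in_set lratio_eqy //; case: (eqVneq (q x) 0) => [->|qn0].
  rewrite mulr0 subr0 andbT max_l //.
  by case: eqVneq => [->|].
have qx0 : 0 < q x by rewrite lt_neqAle eq_sym qn0 q0.
rewrite andbF max_r // subr_le0 -ler_pdivrMr //.
apply: le_trans cge; rewrite (bigD1 x) //= lerDl.
by apply: sumr_ge0 => y _; rewrite divr_ge0.
Qed.

(** Intermediate values from [lo] on: [lo] is 1 for a proper clip and 0 for an unrestricted root.
    Strictness at [lo] makes [c] strictly larger. *)
Lemma excess_attains {p q lo v} : Delta p -> Delta q -> 0 <= lo ->
  v < excess p q lo -> mass p (setHbar p q) <= v ->
  exists2 c, lo < c & excess p q c = v.
Proof.
move=> dp dq lo0 vlo mv; pose C := lo + \sum_x p x / q x.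
have s0 : 0 <= \sum_x p x / q x.
  by apply: sumr_ge0 => x _; rewrite divr_ge0 ?dp.1 ?dq.1.
have EC : excess p q C = mass p (setHbar p q).
  by apply: excess_eq_mass; rewrite // lerDr.
have [|||c] := @IVT R (excess p q) lo C v.
- by rewrite lerDl.
- by apply: continuous_subspaceT; exact: excess_continuous.
- by rewrite EC ge_min le_max mv (ltW vlo) orbT.
rewrite in_itv /= => /andP[loc _] cE; exists c => //.
by rewrite lt_neqAle loc andbT; apply: contraTneq vlo => ->; rewrite cE ltxx.
Qed.

End Excess.

(** * Trimming the upper region *)

Section Clips.
Context {R : realType} {X : finType} {p q : X -> R} {eps : R}.
Hypotheses (dp : Delta p) (dq : Delta q) (eps0 : 0 <= eps).

Let p0 := dp.1.
Let q0 := dq.1.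

Let a_gt0 : 0 < 1 + eps. Proof. by rewrite ltr_wpDr. Qed.

(** The bracket is the minimum of [p x] and [c * q x]; in this form the total mass is
    [(1 + eps) * (1 - excess p q c)]. *)
Lemma p_clipE c x : 0 <= c ->
  p_clip p q eps c x = (1 + eps) * (p x - Num.max (p x - c * q x) 0).
Proof.
move=> c0; rewrite /p_clip finset.in_set lratio_gt //.
by case: ltP => H; [rewrite max_l|rewrite max_r]; lra.
Qed.

(** The clip equation says that trimming removes exactly [eps] from the total mass [1 + eps]. *)
Lemma P_Sub_p_clip c : 0 <= c -> eqU p q eps c ->
  P_Sub p eps (p_clip p q eps c).
Proof.
move=> c0; rewrite /eqU excess_setH // => cE; have a0 := a_gt0.
split; last first.
  move=> x; rewrite p_clipE // ler_pM2l // gerDl oppr_le0.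
  by rewrite le_max lexx orbT.
split=> [x|].
  rewrite p_clipE // pmulr_rge0 // subr_ge0 ge_max p0 gerDl oppr_le0 andbT.
  by rewrite mulr_ge0.
under eq_bigr do rewrite p_clipE //.
rewrite -mulr_sumr sumrB dp.2 -/(excess p q c) cE.
by field; rewrite gt_eqF.
Qed.

(** The factor on [setHbar] removes the surplus [eps] in proportion to [p]; the mass bound keeps
    that factor nonnegative. *)
Lemma P_Sub_p_noclip : eps / (1 + eps) < mass p (setHbar p q) ->
  P_Sub p eps (p_noclip p q eps).
Proof.
set m := mass _ _ => lt_m; have a0 := a_gt0; have an0 := lt0r_neq0 a0.
have d0 : 0 <= eps / (1 + eps) by rewrite divr_ge0 // ltW.
have m0 : 0 < m by exact: le_lt_trans lt_m.
have k0 : 0 <= eps / ((1 + eps) * m) by rewrite divr_ge0 // mulr_ge0 // ltW.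
have k1 : eps / ((1 + eps) * m) <= 1.
  rewrite ler_pdivrMr ?mulr_gt0 // mul1r mulrC -ler_pdivrMr //; exact: ltW.
split; last first.
  move=> x; rewrite /p_noclip; case: ifP => // _.
  by rewrite ler_piMr ?mulr_ge0 // ?(ltW a0) // gerDl oppr_le0.
split=> [x|].
  rewrite /p_noclip -/m; case: ifP => _; rewrite ?mulr_ge0 ?(ltW a0) //.
  by rewrite subr_ge0.
have -> : \sum_x p_noclip p q eps x =
    (1 + eps) * (\sum_x p x - m * (eps / ((1 + eps) * m))).
  rewrite {1}/m massE mulr_suml -sumrB mulr_sumr; apply: eq_bigr => x _.
  by rewrite /p_noclip -/m; case: ifP => _; ring.
by rewrite dp.2; field; rewrite an0 gt_eqF.
Qed.

Lemma upper_cut_clip c : upper_clip p q eps c ->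
  upper_cut p q eps (p_clip p q eps c) (setH p q c) c%:E.
Proof.
move=> [c1 cE]; have c_gt0 : 0 < c by exact: lt_trans c1.
have an0 := lt0r_neq0 a_gt0.
split.
- split=> [|x xH]; first by apply: P_Sub_p_clip => //; exact: ltW.
  by rewrite /p_clip ifN.
- by move=> x; rewrite finset.in_set; apply: lt_trans; rewrite lte_fin.
- move=> x xH; rewrite /p_clip xH -mulrA.
  (* If [q x = 0], the clipped value vanishes too, and the ratio is unconstrained there. *)
  case: (eqVneq ((1 + eps) * q x) 0) => [->|n0 _]; first by rewrite mulr0 eqxx.
  by rewrite inver (negbTE n0) -EFinM mulfK.
- split=> [x|]; first by rewrite finset.in_set -leNgt.
  by rewrite lee_fin ltW.
Qed.

Lemma upper_cut_noclip : eps / (1 + eps) < mass p (setHbar p q) ->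
  upper_cut p q eps (p_noclip p q eps) (setHbar p q) +oo%E.
Proof.
move=> lt_m; have PS := P_Sub_p_noclip lt_m.
split.
- by split=> // x xH; rewrite /p_noclip ifN.
- by move=> x; rewrite finset.in_set => /eqP ->; rewrite ltry.
- move=> x; rewrite finset.in_set lratio_eqy // => /andP[_ /eqP ->].
  rewrite mulr0 eqxx orbF inver eqxx => n0.
  by rewrite gt0_muley // lte_fin lt_neqAle eq_sym n0 PS.1.1.
- by split=> [x _|]; rewrite leey.
Qed.

End Clips.

(** * Trimming the lower region by exchanging [p] and [q] *)

Section LowerClips.
Context {R : realType} {X : finType} {p q : X -> R} {eps : R}.
Hypotheses (dp : Delta p) (dq : Delta q) (eps0 : 0 <= eps).

Let p0 := dp.1.
Let q0 := dq.1.

Let a_gt0 : 0 < 1 + eps. Proof. by rewrite ltr_wpDr. Qed.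

(** The sets [setL p q c] and [setH q p c^-1] differ only where both distributions vanish, and there
    both formulas give 0. *)
Lemma q_clip_swap c : 0 < c -> q_clip p q eps c = p_clip q p eps c^-1.
Proof.
move=> c0; apply/funext => x; rewrite /q_clip /p_clip !finset.in_set.
rewrite lratio_lt // lratio_gt ?invr_ge0 ?(ltW c0) // ltr_pdivrMl //.
case: (eqVneq (p x) 0) => [->|_] /=; last by rewrite [c^-1 * _]mulrC.
rewrite !mulr0; case: ltP => // /le_gtF.
by rewrite pmulr_rgt0 // lt_neqAle q0 andbT eq_sym => /negbFE /eqP ->;
  rewrite mulr0.
Qed.

Lemma q_noclip_swap : q_noclip p q eps = p_noclip q p eps.
Proof.
apply/funext => x; rewrite /q_noclip /p_noclip mass_setLbar // !finset.in_set.
rewrite lratio_eq0 // lratio_eqy //.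
by case: (eqVneq (q x) 0) => [->|//]; rewrite mulr0 mul0r if_same.
Qed.

Lemma eqLo_swap c : 0 < c -> eqLo p q eps c <-> eqU q p eps c^-1.
Proof.
by move=> c0; rewrite /eqLo /eqU excess_setL // excess_setH // invr_ge0 ltW.
Qed.

Lemma lower_cut_clip c : lower_clip p q eps c ->
  lower_cut p q eps (q_clip p q eps c) (setL p q c) c%:E.
Proof.
move=> [/andP[c0 c1] cE]; have an0 := lt0r_neq0 a_gt0.
split.
- split=> [|x xL]; last by rewrite /q_clip ifN.
  rewrite q_clip_swap //; apply: P_Sub_p_clip => //.
    by rewrite invr_ge0 ltW.
  exact/eqLo_swap.
- move=> x; rewrite finset.in_set => /lt_trans; apply.
  by rewrite lte_fin.
- move=> x xL; rewrite /q_clip xL.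
  have [->|pn0] := eqVneq (p x) 0; first by rewrite !mulr0 eqxx.
  move=> _; rewrite inver !mulf_eq0 invr_eq0 (negbTE an0) (negbTE pn0).
  rewrite gt_eqF //= -EFinM; congr _%:E; field.
  by rewrite pn0 an0 gt_eqF.
- split=> [x|]; first by rewrite finset.in_set -leNgt.
  by rewrite !lee_fin !ltW.
Qed.

Lemma lower_cut_noclip : eps / (1 + eps) < mass q (setLbar p q) ->
  lower_cut p q eps (q_noclip p q eps) (setLbar p q) 0%E.
Proof.
move=> lt_m.
split.
- split=> [|x xL]; last by rewrite /q_noclip ifN.
  by rewrite q_noclip_swap; apply: P_Sub_p_noclip; rewrite // -mass_setLbar.
- by move=> x; rewrite finset.in_set => /eqP ->; rewrite lte_fin ltr01.
- move=> x; rewrite finset.in_set lratio_eq0 // => /eqP ->.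
  by rewrite mulr0 mul0e.
- by split=> [x _|]; [exact: lratio_ge0|rewrite lexx lee_fin ler01].
Qed.

End LowerClips.

(** * Existence of the clips *)

Section Existence.
Context {R : realType} {X : finType} {p q : X -> R} {eps : R}.
Hypotheses (dp : Delta p) (dq : Delta q) (eps0 : 0 <= eps).

Let d_lt1 : eps / (1 + eps) < 1.
Proof. by rewrite ltr_pdivrMr ?mul1r ?ltrDr // ltr_wpDr. Qed.

(** If the mass at infinite ratio is at most [eps / (1 + eps)], the excess crosses this level at
    some [c > 1]. *)
Lemma upper_clip_or_mass : eps / (1 + eps) < excess p q 1 ->
  ~ (exists c, upper_clip p q eps c) ->
  eps / (1 + eps) < mass p (setHbar p q).
Proof.
move=> lt_e nex; rewrite ltNge; apply/negP => le_m; apply: nex.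
have [//|c c1 cE] := excess_attains dp dq _ lt_e le_m.
by exists c; split => //; rewrite /eqU excess_setH // ltW // (lt_trans _ c1).
Qed.

(** The same descent started at [c = 0], where the excess is 1, yields a positive root that may lie
    below 1. *)
Lemma eqU_or_mass : ~ (exists c, 0 < c /\ eqU p q eps c) ->
  eps / (1 + eps) < mass p (setHbar p q).
Proof.
move=> nex; rewrite ltNge; apply/negP => le_m; apply: nex.
have lt_e : eps / (1 + eps) < excess p q 0 by rewrite excess0.
have [//|c c0 cE] := excess_attains dp dq _ lt_e le_m.
by exists c; split => //; rewrite /eqU excess_setH // ltW.
Qed.

(* Otherwise the normalised minimum of [p] and [q] is a common element. *)
Lemma disjoint_excess : P_Sub p eps `&` P_Sub q eps = set0 ->
  eps / (1 + eps) < excess p q 1.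
Proof.
move=> dis; rewrite ltNge; apply/negP => le_e.
have a0 : 0 < 1 + eps by rewrite ltr_wpDr.
pose s := \sum_x Num.min (p x) (q x).
have sE : s = 1 - excess p q 1.
  rewrite -[X in X - _]dp.2 /s /excess -sumrB; apply: eq_bigr => x _.
  by rewrite mul1r; case: (leP (p x) (q x)) => H;
    [rewrite max_r|rewrite max_l]; lra.
(* The common mass [s] is at least [1 / (1 + eps)], so normalising multiplies by at most
   [1 + eps]. *)
have as1 : 1 <= (1 + eps) * s.
  rewrite mulrC -ler_pdivrMr // sE lerBrDr -lerBrDl.
  apply: le_trans le_e _; rewrite le_eqVlt; apply/orP; left; apply/eqP.
  by field; rewrite gt_eqF.
have s0 : 0 < s by rewrite -(pmulr_rgt0 _ a0) (lt_le_trans _ as1).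
have sa : s^-1 <= 1 + eps.
  by rewrite invf_ple ?posrE // -[leLHS]mulr1 ler_pdivrMl.
have m0 x : 0 <= Num.min (p x) (q x) by rewrite le_min dp.1 dq.1.
have dm : Delta (fun x => s^-1 * Num.min (p x) (q x)).
  split=> [x|]; first by rewrite mulr_ge0 // invr_ge0 ltW.
  by rewrite -mulr_sumr mulVf // gt_eqF.
suff : (P_Sub p eps `&` P_Sub q eps) (fun x => s^-1 * Num.min (p x) (q x)).
  by rewrite dis.
split; split => // x; apply: ler_pM => //; rewrite ?invr_ge0 ?(ltW s0) //.
  by rewrite ge_min lexx.
by rewrite ge_min lexx orbT.
Qed.

End Existence.

Lemma upper_clip_swap {R : realType} {X : finType} {p q : X -> R} {eps : R} :
  Delta p -> Delta q ->
  (exists c, upper_clip q p eps c) -> exists c, lower_clip p q eps c.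
Proof.
move=> dp dq [c [c1 cE]]; have c0 : 0 < c by exact: lt_trans c1.
exists c^-1; split; first by rewrite invr_gt0 c0 invf_lt1.
by apply/eqLo_swap; rewrite ?invr_gt0 // invrK.
Qed.

Theorem theorem3p4 (R : realType) (X : finType) (p q : X -> R) (eps : R)
    (hp : Delta p) (hq : Delta q) (heps : 0 <= eps < 1) :
  let PP := P_Sub p eps in
  let QQ := P_Sub q eps in
  let delta := eps / (1 + eps) in
  [/\ forall c' c'' : R, lower_clip p q eps c' -> upper_clip p q eps c'' ->
        least_favourable PP QQ (p_clip p q eps c'') (q_clip p q eps c'),
      [/\ PP `&` QQ = set0 -> ~ (exists c'' : R, upper_clip p q eps c'') ->
            delta < mass p (setHbar p q),
          ~ (exists c'' : R, 0 < c'' /\ eqU p q eps c'') ->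
            delta < mass p (setHbar p q) &
          delta < mass p (setHbar p q) ->
            (forall c', lower_clip p q eps c' ->
               least_favourable PP QQ (p_noclip p q eps) (q_clip p q eps c')) /\
            (~ (exists c' : R, lower_clip p q eps c') ->
               least_favourable PP QQ (p_noclip p q eps) (q_noclip p q eps))] &
      [/\ PP `&` QQ = set0 -> ~ (exists c' : R, lower_clip p q eps c') ->
            delta < mass q (setLbar p q),
          ~ (exists c' : R, 0 < c' /\ eqLo p q eps c') ->
            delta < mass q (setLbar p q) &
          delta < mass q (setLbar p q) ->
            (forall c'', upper_clip p q eps c'' ->
               least_favourable PP QQ (p_clip p q eps c'') (q_noclip p q eps)) /\
            (~ (exists c'' : R, upper_clip p q eps c'') ->
               least_favourable PP QQ (p_noclip p q eps) (q_noclip p q eps))]].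
Proof.
have [eps0 _] := andP heps; move=> PP QQ delta.
have nolower : delta < excess p q 1 ->
    ~ (exists c' : R, lower_clip p q eps c') -> delta < mass q (setLbar p q).
  move=> lt_e nex; rewrite mass_setLbar //.
  apply: (upper_clip_or_mass hq hp); first by rewrite (excess1C hq hp).
  by move=> /(upper_clip_swap hp hq).
have noupper := upper_clip_or_mass hp hq.
have noclips : delta < mass p (setHbar p q) -> delta < mass q (setLbar p q) ->
    least_favourable PP QQ (p_noclip p q eps) (q_noclip p q eps).
  move=> Hm Lm; apply: (cut_least_favourable hp hq eps0).
    exact: upper_cut_noclip.
  exact: lower_cut_noclip.
split.
- move=> c' c'' lo up; apply: (cut_least_favourable hp hq eps0).
    exact: upper_cut_clip.
  exact: lower_cut_clip.
- split.
  + by move=> dis; apply: noupper; exact: disjoint_excess.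
  + exact: eqU_or_mass.
  + move=> Hm; split=> [c' lo|nex].
      apply: (cut_least_favourable hp hq eps0); first exact: upper_cut_noclip.
      exact: lower_cut_clip.
    (* [excess p q 1] is at least the mass at infinite ratio, so the mass bound of this case
       supplies what disjointness gave above. *)
    apply: noclips => //; apply: nolower => //.
    exact: lt_le_trans Hm (excess_ge_mass q 1 hp).
- split.
  + by move=> dis; apply: nolower; exact: disjoint_excess.
  + move=> nex; rewrite mass_setLbar //; apply: eqU_or_mass => // -[c [c0 cE]].
    apply: nex; exists c^-1; split; first by rewrite invr_gt0.
    by apply/eqLo_swap; rewrite ?invr_gt0 // invrK.
  + move=> Lm; split=> [c'' up|nex].
      apply: (cut_least_favourable hp hq eps0); first exact: upper_cut_clip.
      exact: lower_cut_noclip.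
    apply: noclips => //; apply: noupper => //.
    (* By symmetry of the excess at 1, the [q]-mass of [setLbar] bounds it from below as well. *)
    rewrite excess1C //; apply: lt_le_trans (excess_ge_mass p 1 hq).
    by rewrite -mass_setLbar.
Qed.
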